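(* Let $n\ge 2$ and $m$ be integers with $(n-1)^2\le m< n(n-1)$. Among all simple directed graphs with $n$ vertices and $m$ arcs, the maximal algebraic connectivity is $n-1$, and such a graph $\mathbb G$ has algebraic connectivity $n-1$ if and only if its complement $\overline{\mathbb G}$ is a directed forest consisting of $m-n(n-2)$ directed trees.
   Context: A simple directed graph has no self-arcs and no repeated arcs; an arc $(j,i)$ goes from $j$ to $i$. The (in-degree) Laplacian of $\mathbb G$ on vertices $\{1,\dots,n\}$ is $L(\mathbb G)=D-A$, $D$ the diagonal matrix of in-degrees, $A_{ij}=1$ if $(j,i)$ is an arc and $0$ otherwise. The algebraic connectivity $a(\mathbb G)$ is the second smallest real part among the $n$ eigenvalues of $L(\mathbb G)$ counted with algebraic multiplicity (the smallest is always $0$). The complement $\overline{\mathbb G}$ is the simple directed graph on the same vertex set whose arcs are exactly the ordered pairs $(i,j)$, $i\ne j$, that are not arcs of $\mathbb G$. A vertex $r$ is a root if there is a directed path from $r$ to every other vertex; a directed tree on $k$ vertices is a directed graph with a root and $k-1$ arcs (a single vertex is a directed tree). A directed forest is a vertex-disjoint union of directed trees covering all vertices, with no arcs between different trees. *)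

(* Defs.v *)
From HB Require Import structures.
From mathcomp Require Import all_boot all_order all_algebra all_field.
Set Implicit Arguments. Unset Strict Implicit. Unset Printing Implicit Defensive.
Import Order.TTheory GRing.Theory Num.Theory.
Local Open Scope ring_scope.

(* A directed graph on vertex set 'I_n is its set of arcs; (j,i) is an arc j -> i. *)
Definition digraph (n : nat) := {set 'I_n * 'I_n}.

(* simple: no self-arcs (repeated arcs are impossible in a set). *)
Definition simple_digraph n (G : digraph n) : Prop := forall i : 'I_n, (i, i) \notin G.

Definition indeg n (G : digraph n) (i : 'I_n) : nat := #|[set j | (j, i) \in G]|.

Definition laplacian n (G : digraph n) : 'M[algC]_n :=
  \matrix_(i, j) (if i == j then (indeg G i)%:R
                  else - ((j, i) \in G)%:R).

(* The n eigenvalues of L counted with algebraic multiplicity: the roots of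
   the (monic) characteristic polynomial, with multiplicity. *)
Definition eigs n (G : digraph n) : seq algC :=
  sval (closed_field_poly_normal (char_poly (laplacian G))).

Definition alg_conn n (G : digraph n) : algC :=
  nth 0 (sort <=%R (map (fun z => 'Re z) (eigs G))) 1.

Definition complement n (G : digraph n) : digraph n :=
  [set p | (p.1 != p.2) && (p \notin G)].

Definition is_dtree n (G : digraph n) (B : {set 'I_n}) : Prop :=
  (exists2 r, r \in B &
     forall v, v \in B ->
       connect [rel x y | [&& x \in B, y \in B & (x, y) \in G]] r v)
  /\ #|[set p in G | (p.1 \in B) && (p.2 \in B)]| = (#|B| - 1)%N.

Definition directed_forest n (G : digraph n) (k : nat) : Prop :=
  exists P : {set {set 'I_n}},
    [/\ partition P [set: 'I_n], #|P| = k,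
        (forall p, p \in G -> pblock P p.1 = pblock P p.2)
      & forall B, B \in P -> is_dtree G B].

(* Main.v *)
(* Let H be the complement of G, with e = n(n-1) - m arcs, 1 <= e <= n-1.  Since
   L(G) + J = nI - L(H) and L(G) kills the all-ones vector, a rank-one update of
   the characteristic polynomial shows that the eigenvalues of G are 0 and the
   n - z, where z runs over the eigenvalues of H with one 0 removed.  Hence
   a(G) = n - 1 amounts to max Re z = 1, and a(G) <= n - 1 to max Re z >= 1.

   The eigenvalues of H sum to tr L(H) = e, and at most rank L(H) of them are
   nonzero.  As rows of in-degree 0 vanish, rank L(H) is at most the number of
   vertices of positive in-degree, hence at most e.  So max Re z >= 1, and
   max Re z <= 1 forces rank L(H) = e, whence every in-degree is at most 1 and
   every vertex is reachable from one of in-degree 0: otherwise the rows of the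
   unreachable vertices are dependent and the rank drops.  These two conditions
   characterise directed forests with n - e trees, and conversely they imply, by
   propagating an eigenvector along arcs, that the eigenvalues of H are 0 or 1. *)
Require Import Defs.
From HB Require Import structures.
From mathcomp Require Import all_boot all_order all_algebra all_field.
Set Implicit Arguments. Unset Strict Implicit. Unset Printing Implicit Defensive.
Import Order.TTheory GRing.Theory Num.Theory.
Local Open Scope ring_scope.

(** * Characteristic polynomials, their roots and the rank *)

(* Both sides are det [[A, u], [v, 1]] * x, the block matrix being reduced by
   column operations in two ways. *)
Lemma det_rank1_update (R : comNzRingType) (n : nat) (A : 'M[R]_n)
    (u : 'cV[R]_n) (v : 'rV[R]_n) (x : R) :
  A *m u = x *: u -> \det (A - u *m v) * x = \det A * (x - (v *m u) 0 0).
Proof.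
move=> Au; set Z := block_mx A u v (1%:M : 'M_1).
have dZ : \det Z = \det (A - u *m v).
  have := det_mulmx Z (block_mx 1%:M 0 (- v) 1%:M).
  rewrite det_lblock !det1 !mulr1 => <-.
  rewrite mulmx_block !mulmx1 !mul1mx !mulmx0 !add0r mulmxN subrr.
  by rewrite det_ublock det1 mulr1.
have := det_mulmx Z (block_mx 1%:M (- u) 0 x%:M).
rewrite det_ublock det1 mul1r det_scalar1 dZ => <-.
rewrite mulmx_block !mulmx1 !mulmx0 !addr0 !mulmxN Au mul_mx_scalar addNr mul1mx.
by rewrite det_lblock det_mx11 !mxE addrC eqxx mulr1n.
Qed.

(** Over the polynomial ring, [u] is an eigenvector of [char_poly_mx A] for the eigenvalue ['X], so
    the determinant identity applies. *)
Lemma char_poly_rank1_update (R : comNzRingType) (n : nat) (A : 'M[R]_n)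
    (u : 'cV[R]_n) (v : 'rV[R]_n) :
  A *m u = 0 ->
  char_poly (A + u *m v) * 'X = char_poly A * ('X - ((v *m u) 0 0)%:P).
Proof.
move=> Au.
have /det_rank1_update-/(_ (map_mx polyC v)) :
    char_poly_mx A *m map_mx polyC u = 'X *: map_mx polyC u.
  by rewrite /char_poly_mx mulmxBl -map_mxM Au map_mx0 subr0 mul_scalar_mx.
rewrite -!map_mxM mxE => <-; congr (\det _ * _).
by rewrite /char_poly_mx map_mxD opprD addrA.
Qed.

(** The block matrix [[X, A], [B, 1]] is reduced by column operations in two ways. *)
Lemma char_poly_mulmx_comm (R : comNzRingType) (m n : nat) (A : 'M[R]_(m, n))
    (B : 'M[R]_(n, m)) :
  char_poly (A *m B) * 'X^n = char_poly (B *m A) * 'X^m.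
Proof.
set A' := map_mx polyC A; set B' := map_mx polyC B.
pose Z := block_mx ('X%:M : 'M_m) A' B' (1%:M : 'M_n).
have dZ : \det Z = char_poly (A *m B).
  have := det_mulmx Z (block_mx 1%:M 0 (- B') 1%:M).
  rewrite det_lblock !det1 !mulr1 => <-.
  rewrite mulmx_block !mulmx1 !mul1mx !mulmx0 !add0r mulmxN subrr.
  by rewrite det_ublock det1 mulr1 -map_mxM.
have := det_mulmx Z (block_mx 1%:M (- A') 0 'X%:M).
rewrite det_ublock det1 mul1r det_scalar dZ => <-.
rewrite mulmx_block !mulmx1 !mulmx0 !addr0 !mulmxN mul_mx_scalar mul_scalar_mx addNr mul1mx.
by rewrite det_lblock det_scalar mulrC addrC -map_mxM.
Qed.

Lemma char_poly_scalarB (R : comNzRingType) (n : nat) (A : 'M[R]_n) (c : R) :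
  char_poly (c%:M - A) = (-1) ^+ n * (char_poly A \Po (c%:P - 'X)).
Proof.
rewrite /char_poly -(det_map_mx (comp_poly (c%:P - 'X))) -detZ; congr (\det _).
apply/matrixP=> i j; rewrite !mxE !rmorphB /= !rmorphMn /= comp_polyX comp_polyC.
by rewrite mulN1r opprB mulrnBl opprB addrCA opprB.
Qed.

Lemma char_poly_scalarB_roots (R : comNzRingType) (n : nat) (A : 'M[R]_n) (c : R)
    (s : seq R) :
  char_poly A = \prod_(z <- s) ('X - z%:P) ->
  char_poly (c%:M - A) = \prod_(z <- [seq c - z | z <- s]) ('X - z%:P).
Proof.
move=> chA; have sz : size s = n.
  by apply: succn_inj; rewrite -(size_char_poly A) chA size_prod_XsubC.
rewrite char_poly_scalarB chA rmorph_prod big_map -sz /=.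
elim: {sz chA}s => [|z s IHs] /=; first by rewrite !big_nil mulr1.
rewrite !big_cons -IHs exprS mulrACA rmorphB /= comp_polyX comp_polyC polyCB.
by rewrite mulN1r; congr (_ * _); rewrite !opprB addrCA.
Qed.

(** A rank factorisation [A = C R] makes [char_poly A * 'X^(\rank A)] equal to
    [char_poly (R C) * 'X^n]; hence 0 is a root of [char_poly A] of multiplicity at least
    [n - \rank A]. *)
Lemma count_nonzero_roots_le_rank (F : fieldType) (n : nat) (A : 'M[F]_n) (s : seq F) :
  char_poly A = \prod_(z <- s) ('X - z%:P) ->
  (count (predC1 0%R) s <= \rank A)%N.
Proof.
move=> chA; have sz : size s = n.
  by apply: succn_inj; rewrite -(size_char_poly A) chA size_prod_XsubC.
have := char_poly_mulmx_comm (col_base A) (row_base A).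
rewrite mulmx_base chA => /(congr1 (mup 0)).
have X0 k : ('X^k : {poly F}) != 0 by rewrite expf_neq0 ?polyX_eq0.
have muX k : mup (0 : F) 'X^k = k by rewrite -(subr0 'X) mup_XsubCX eqxx.
rewrite !mupM ?X0 ?monic_neq0 ?char_poly_monic -?chA ?char_poly_monic // chA.
rewrite mu_prod_XsubC !muX -(leq_add2l (count_mem 0 s)) => ->.
by rewrite count_predC sz leq_addl.
Qed.

Lemma sum_roots_char_poly (R : comNzRingType) (n : nat) (A : 'M[R]_n) (s : seq R) :
  char_poly A = \prod_(z <- s) ('X - z%:P) -> \sum_(z <- s) z = \tr A.
Proof.
move=> chA; have sz : size s = n.
  by apply: succn_inj; rewrite -(size_char_poly A) chA size_prod_XsubC.
have [s0 | s_gt0] := posnP (size s).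
  rewrite (size0nil s0) big_nil /mxtrace big1 // => i.
  by have := ltn_ord i; rewrite -{2}sz s0.
apply: oppr_inj; rewrite -char_poly_trace ?chA -?sz //.
by rewrite coefPn_prod_XsubC // -lt0n.
Qed.

(** * The second smallest entry of a real sequence *)

(** The bound says that at most one entry of [a :: t] is below [c], and [a] already is one. *)
Lemma second_smallest_ge (R : numDomainType) (a c : R) (t : seq R) :
    a \is Num.real -> c \is Num.real -> all (mem Num.real) t -> a < c -> t != [::] ->
  (c <= nth 0 (sort <=%R (a :: t)) 1) = all (fun x => c <= x) t.
Proof.
move=> Ra Rc Rt lt_ac t0; set s := a :: t; set u := sort _ _.
have Rs : all (mem Num.real) s by rewrite /= Ra.
have us : perm_eq u s by rewrite perm_sort.
have Ru x : x \in u -> x \is Num.real.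
  by rewrite (perm_mem us) => /(allP Rs).
have su : sorted <=%R u by apply: sort_sorted_in Rs => x y /= Rx Ry; exact: real_leVge.
have szu : (1 < size u)%N by rewrite (perm_size us) /= ltnS lt0n size_eq0.
have -> : all (fun x => c <= x) t = (count (fun x => (x < c)%R) u <= 1)%N.
  rewrite (permP us) /= lt_ac ltnS leqn0 -[RHS]negbK -lt0n -has_count -all_predC.
  by apply: eq_in_all => x /(allP Rt) Rx; rewrite /= -real_leNgt.
have Ru1 : nth 0 u 1 \is Num.real by rewrite Ru ?mem_nth.
rewrite real_leNgt // leqNgt; congr (~~ _); apply/idP/idP => [lt1|]; last first.
  exact: nth_count_lt.
have lt0 : nth 0 u 0 < c.
  by apply: le_lt_trans lt1; apply: le_sorted_leq_nth; rewrite // inE ltnW.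
by case: (u) szu lt0 lt1 => [|x [|y v]] //= _ -> ->.
Qed.

(** * In-degrees and complements *)

Definition arc n (G : digraph n) : rel 'I_n := [rel x y | (x, y) \in G].

(** Degree and reachability form of a directed forest, compared below with the spectrum on one side
    and with [directed_forest] on the other. *)
Definition branching n (G : digraph n) : Prop :=
  (forall i, (indeg G i <= 1)%N) /\
  (forall v, exists2 r, indeg G r = 0%N & connect (arc G) r v).

Section Digraph.
Variable n : nat.
Implicit Types G H : digraph n.

Lemma sum_indeg G : (\sum_i indeg G i = #|G|)%N.
Proof.
rewrite -sum1_card (partition_big snd xpredT) //=; apply: eq_bigr => i _.
have pairI : injective (fun j : 'I_n => (j, i)) by move=> j k [].
rewrite sum1dep_card /indeg -(card_imset _ pairI); apply: eq_card => -[j k].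
apply/imsetP/idP => [[l] | ]; rewrite inE.
  by move=> Gli [-> ->]; rewrite inE Gli eqxx.
by case/andP=> Gjk /eqP/= ki; exists j; rewrite -?ki // inE.
Qed.

Lemma indeg_eq0P G i : reflect (forall j, (j, i) \notin G) (indeg G i == 0%N).
Proof.
rewrite cards_eq0; apply: (iffP eqP) => [G0 j | G0].
  by have := in_set0 j; rewrite -G0 inE => ->.
by apply/setP=> j; rewrite !inE (negPf (G0 j)).
Qed.

Lemma indeg_le1_uniq G i j k :
  (indeg G i <= 1)%N -> (j, i) \in G -> (k, i) \in G -> j = k.
Proof. by move=> /card_le1_eqP G1 Gj Gk; apply: G1; rewrite inE. Qed.

Lemma complement_simple G : simple_digraph (complement G).
Proof. by move=> i; rewrite inE eqxx. Qed.

Lemma complementK G : simple_digraph G -> complement (complement G) = G.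
Proof.
move=> sG; apply/setP=> -[i j]; rewrite !inE /= negb_and !negbK.
by case: eqVneq => // <-; rewrite (negPf (sG i)).
Qed.

Lemma indeg_complement G i :
  simple_digraph G -> (indeg G i + indeg (complement G) i).+1 = n.
Proof.
move=> sG; rewrite -[RHS]card_ord -(cardsC (i |: [set j | (j, i) \in G])).
rewrite cardsU1 inE sG add1n addSn; congr (_ + _).+1; apply: eq_card => j.
by rewrite !inE negb_or.
Qed.

Lemma card_complement G :
  simple_digraph G -> (#|G| + #|complement G| = n * n.-1)%N.
Proof.
move=> sG; rewrite -!sum_indeg -big_split /=.
rewrite (eq_bigr (fun=> n.-1)) ?sum_nat_const ?card_ord // => i _.
by rewrite -[RHS](congr1 predn (indeg_complement i sG)).
Qed.

(** * Laplacian and spectrum of the complement *)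

Lemma laplacian_complement G : simple_digraph G ->
  laplacian G + (const_mx 1 : 'cV_n) *m (const_mx 1 : 'rV_n) = n%:R%:M - laplacian (complement G).
Proof.
move=> sG; apply/matrixP=> i j; rewrite !mxE big_ord1 !mxE mulr1.
case: eqVneq => [_ | ij].
  have -> : n%:R = (indeg G i + indeg (complement G) i).+1%:R :> algC.
    by rewrite indeg_complement.
  by rewrite -natr1 natrD mulr1n addrAC addrK.
rewrite mulr0n sub0r opprK inE /= eq_sym ij /=.
by case: (_ \in G); rewrite /= ?oppr0 ?add0r ?addNr.
Qed.

Lemma row_laplacian G i : simple_digraph G ->
  row i (laplacian G) =
    \sum_(j | (j, i) \in G) (delta_mx 0 i - delta_mx 0 j : 'rV[algC]_n).
Proof.
move=> sG; apply/rowP=> k; rewrite !mxE sumrB !mxE !summxE.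
under eq_bigr do rewrite mxE eqxx /=.
under [X in _ - X]eq_bigr do rewrite mxE eqxx /=.
have -> : \sum_(j | (j, i) \in G) (k == j)%:R = ((k, i) \in G)%:R :> algC.
  case: (boolP (_ \in G)) => [Gki | nGki]; last first.
    by rewrite big1 // => j; case: eqVneq => // <-; rewrite (negPf nGki).
  rewrite (bigD1 k) //= eqxx big1 ?addr0 // => j /andP[_ jk].
  by rewrite eq_sym (negPf jk).
have -> : \sum_(j | (j, i) \in G) (k == i)%:R = (k == i)%:R *+ indeg G i :> algC.
  by rewrite sumr_const /indeg cardsE.
rewrite eq_sym; case: eqVneq => [-> | _]; first by rewrite (negPf (sG i)) subr0.
by rewrite mul0rn sub0r.
Qed.

Lemma laplacian_const1 G : simple_digraph G ->
  laplacian G *m const_mx 1 = 0 :> 'cV_n.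
Proof.
move=> sG; apply/row_matrixP=> i; rewrite row_mul row_laplacian // row0.
rewrite mulmx_suml big1 // => j _; apply/rowP=> k.
by rewrite mulmxBl -!rowE !mxE subrr.
Qed.

Lemma eigsE G : char_poly (laplacian G) = \prod_(z <- eigs G) ('X - z%:P).
Proof.
rewrite /eigs; case: closed_field_poly_normal => s /= {1}->.
by rewrite (monicP (char_poly_monic _)) scale1r.
Qed.

Lemma sum_eigs G : \sum_(z <- eigs G) z = #|G|%:R.
Proof.
rewrite (sum_roots_char_poly (eigsE G)) -sum_indeg natr_sum.
by apply: eq_bigr => i _; rewrite mxE eqxx.
Qed.

(** Adding the all-ones matrix trades a root 0 of the characteristic polynomial for [n]. As [n] is
    nonzero, it must be some [n - z] on the complement side, which forces [z = 0]; cancelling this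
    pair leaves the spectrum of [G]. *)
Lemma eigs_complement G : (0 < n)%N -> simple_digraph G ->
  0 \in eigs (complement G) /\
  perm_eq (eigs G) (0 :: [seq n%:R - z | z <- rem 0 (eigs (complement G))]).
Proof.
move=> n_gt0 sG; set s := eigs (complement G).
have n0 : n%:R != 0 :> algC by rewrite pnatr_eq0 -lt0n.
have Ep : perm_eq (n%:R :: eigs G) (0 :: [seq n%:R - z | z <- s]).
  apply: prod_XsubC_eq; rewrite !big_cons -eigsE polyC0 subr0.
  rewrite -(char_poly_scalarB_roots _ (eigsE (complement G))).
  rewrite -laplacian_complement // mulrC [RHS]mulrC.
  have E := char_poly_rank1_update (const_mx 1) (laplacian_const1 sG).
  rewrite E mxE.
  under eq_bigr do rewrite !mxE mulr1.
  by rewrite sumr_const card_ord.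
have s0 : 0 \in s.
  have : n%:R \in 0 :: [seq n%:R - z | z <- s] by rewrite -(perm_mem Ep) mem_head.
  rewrite inE (negPf n0) => /mapP[z sz /eqP].
  by rewrite eq_sym subr_eq addrC -subr_eq subrr => /eqP->.
split=> //; rewrite -(perm_cons n%:R) (perm_trans Ep) //.
have := perm_map (fun z => n%:R - z) (perm_to_rem s0).
rewrite /= subr0 => /permP cnt; apply/permP=> p /=.
by rewrite cnt /= addnCA.
Qed.

(** * Rank of the Laplacian *)

Lemma rank_le_card m (A : 'M[algC]_(m, n)) (B : {set 'I_n}) (w : 'I_n -> 'rV_n) :
  (forall i, (row i A <= \sum_(j in B) <<w j>>)%MS) -> (\rank A <= #|B|)%N.
Proof.
move=> /row_subP/mxrankS/leq_trans-> //.
rewrite (leq_trans (mxrank_sum_leqif _)) //= -sum1_card leq_sum // => i _.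
by rewrite mxrank_gen rank_leq_row.
Qed.

Lemma rank_laplacian_le G : simple_digraph G ->
  (\rank (laplacian G) <= #|[set i | indeg G i != 0%N]|)%N.
Proof.
move=> sG; apply: (@rank_le_card _ _ _ (fun i => row i (laplacian G))) => i.
have [/indeg_eq0P G0 | Gi] := boolP (indeg G i == 0%N).
  by rewrite row_laplacian // big_pred0 ?sub0mx // => j; apply/negbTE.
by rewrite (sumsmx_sup i) ?inE // genmxE.
Qed.

(* If [t] is unreachable from the vertices of in-degree 0, so are the tails of
   all arcs into the unreachable set [T]; the rows of the Laplacian indexed by
   [T] then lie in the span of the [e_j - e_t], [j] in [T :\ t]. *)
Lemma rank_laplacian_lt G t : simple_digraph G ->
    (forall r, indeg G r = 0%N -> ~~ connect (arc G) r t) ->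
  (\rank (laplacian G) < #|[set i | indeg G i != 0%N]|)%N.
Proof.
move=> sG nt; set S := [set i | _].
pose T := [set v | [forall r, (indeg G r == 0%N) ==> ~~ connect (arc G) r v]].
have inT v : reflect (forall r, indeg G r = 0%N -> ~~ connect (arc G) r v) (v \in T).
  rewrite inE; apply: (iffP forall_inP) => [T1 r /eqP/T1 // | T1 r /eqP/T1 //].
have Tt : t \in T by apply/inT.
have sTS : T \subset S.
  apply/subsetP=> v /inT Tv; rewrite inE; apply/eqP=> /Tv.
  by rewrite connect0.
have T_tail i j : i \in T -> (j, i) \in G -> j \in T.
  move=> /inT Ti Gji; apply/inT=> r /Ti; apply: contra => rj.
  exact: connect_trans rj (connect1 _).
rewrite (cardsD1 t S) (subsetP sTS) // ltnS.
pose e j : 'rV[algC]_n := delta_mx 0 j - delta_mx 0 t.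
apply: (@rank_le_card _ _ _ (fun i => if i \in T then e i else row i (laplacian G))) => i.
set V := (\sum_(j in _) _)%MS.
have eV j : j \in T -> (e j <= V)%MS.
  move=> Tj; have [-> | jt] := eqVneq j t; first by rewrite /e subrr sub0mx.
  by rewrite (sumsmx_sup j) ?Tj ?genmxE // inE inE jt (subsetP sTS).
have [Ti | nTi] := boolP (i \in T).
  rewrite row_laplacian // summx_sub // => j Gji.
  have -> : delta_mx 0 i - delta_mx 0 j = e i - e j.
    by rewrite /e opprB addrA subrK.
  apply: addmx_sub; first exact: eV.
  by rewrite eqmx_opp eV // (T_tail i).
have [/indeg_eq0P G0 | Gi] := boolP (indeg G i == 0%N).
  by rewrite row_laplacian // big_pred0 ?sub0mx // => j; apply/negbTE.
rewrite (sumsmx_sup i) ?(negPf nTi) ?genmxE // !inE Gi andbT.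
by apply: contraNneq nTi => ->.
Qed.

(** * Eigenvalues and branchings *)

(** With [c] nonzero eigenvalues, the sum of [1 - 'Re z] over them is [c - #|G|], nonnegative by
    hypothesis, while [c <= \rank (laplacian G) <= #|S| <= #|G|]. All of these are equalities, and
    each conclusion is read off one of them. *)
Lemma branching_of_eigs G : simple_digraph G -> (0 < #|G|)%N ->
    (forall z, z \in eigs G -> 'Re z <= 1) ->
  branching G /\ exists2 z, z \in eigs G & 'Re z = 1.
Proof.
move=> sG G_gt0 Re1; set S := [set i | indeg G i != 0%N].
set c := count (predC1 0%R) (eigs G).
have c_rank : (c <= \rank (laplacian G))%N.
  exact: count_nonzero_roots_le_rank (eigsE G).
have SG : (#|S| + \sum_i (indeg G i).-1 = #|G|)%N.
  rewrite -sum_indeg -sum1_card [X in (X + _)%N]big_mkcond -big_split /=.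
  by apply: eq_bigr => i _; rewrite inE; case: (indeg G i).
have sumRe : \sum_(z <- eigs G | (z \in eigs G) && (z != 0)) (1 - 'Re z) =
    c%:R - #|G|%:R.
  rewrite -big_seq_cond sumrB /c -sum1_count natr_sum; congr (_ - _).
  have <- : 'Re (#|G|%:R : algC) = #|G|%:R by apply/Creal_ReP; rewrite realn.
  rewrite -sum_eigs raddf_sum big_mkcond /=.
  by apply: eq_bigr => z _; case: eqVneq => // ->; rewrite raddf0.
have pos z : (z \in eigs G) && (z != 0) -> 0 <= 1 - 'Re z.
  by case/andP=> /Re1; rewrite subr_ge0.
have Gc : (#|G| <= c)%N by rewrite -(ler_nat algC) -subr_ge0 -sumRe sumr_ge0.
have rS := rank_laplacian_le sG.
have SleG : (#|S| <= #|G|)%N by rewrite -SG leq_addr.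
have cG : c = #|G|.
  by apply/eqP; rewrite eqn_leq Gc andbT (leq_trans c_rank) ?(leq_trans rS).
have GS : #|G| = #|S|.
  by apply/eqP; rewrite eqn_leq SleG andbT -cG (leq_trans c_rank).
split; last first.
  have: has (predC1 0) (eigs G) by rewrite has_count -/c cG.
  case/hasP=> z Gz /= z0; exists z => //.
  move/eqP: sumRe; rewrite cG subrr psumr_eq0 // => /allP/(_ z Gz).
  by rewrite Gz z0 /= subr_eq0 => /eqP.
split=> [i | v].
  move/eqP: SG; rewrite GS -[X in _ == X]addn0 eqn_add2l sum_nat_eq0.
  by move=> /forallP/(_ i)/eqP; case: (indeg G i) => [|[]].
have [/exists_inP[r /eqP Gr rv] | nr] :=
  boolP [exists (r | indeg G r == 0%N), connect (arc G) r v]; first by exists r.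
have nt r : indeg G r = 0%N -> ~~ connect (arc G) r v.
  by move=> Gr; apply: contra nr => rv; apply/exists_inP; exists r; rewrite ?Gr.
by have := rank_laplacian_lt sG nt; rewrite -GS -cG ltnNge c_rank.
Qed.

(** If [L v = z v], then [z v_r = 0] at a vertex [r] of in-degree 0, and [v_r = 0] gives
    [(1 - z) v_k = 0] along the only arc into [k]. Were [z] neither 0 nor 1, [v] would vanish
    everywhere. *)
Lemma branching_eigs G z :
  simple_digraph G -> branching G -> z \in eigs G -> z = 0 \/ z = 1.
Proof.
move=> sG [G1 Groot] Gz.
(* [eigenvalue] concerns row vectors; the transpose yields a right eigenvector of the Laplacian. *)
have : root (char_poly (laplacian G)^T) z.
  rewrite /char_poly -det_tr /char_poly_mx linearB /= tr_scalar_mx.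
  by rewrite -map_trmx trmxK -/(char_poly _) eigsE root_prod_XsubC.
rewrite -eigenvalue_root_char => /eigenvalueP[v vL v0].
have eq_v i : \sum_(j | (j, i) \in G) (v 0 i - v 0 j) = z * v 0 i.
  have <- : (v *m (laplacian G)^T) 0 i = z * v 0 i by rewrite vL mxE.
  transitivity ((row i (laplacian G) *m v^T) 0 0).
    rewrite row_laplacian // mulmx_suml summxE; apply: eq_bigr => j _.
    by rewrite mulmxBl -!rowE !mxE.
  by rewrite !mxE; apply: eq_bigr => j _; rewrite !mxE mulrC.
have [-> | z0] := eqVneq z 0; [by left | right].
have [-> // | z1] := eqVneq z 1.
case/eqP: v0; apply/rowP=> i; rewrite mxE.
have [r /eqP/indeg_eq0P Gr /connectP[p]] := Groot i.
have : v 0 r = 0.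
  move/esym/eqP: (eq_v r); rewrite big_pred0 => [|j]; last exact/negbTE.
  by rewrite mulf_eq0 (negPf z0) => /eqP.
elim: p r {Gr} => [|k p IHp] r vr /= => [_ -> // | /andP[Grk kp] ip].
apply: IHp kp ip; move: (eq_v k).
rewrite (big_pred1 r) => [|j]; last first.
  by apply/idP/eqP => [Gjk | -> //]; apply: indeg_le1_uniq Gjk Grk.
rewrite vr subr0 -[LHS]mul1r => /eqP; rewrite -subr_eq0 -mulrBl mulf_eq0.
by rewrite subr_eq0 eq_sym (negPf z1) => /eqP.
Qed.

(** * Algebraic connectivity through the complement *)

Lemma alg_conn_eq_second G : (0 < n)%N -> simple_digraph G ->
  alg_conn G =
    nth 0 (sort <=%R (0 :: [seq n%:R - 'Re z | z <- rem 0 (eigs (complement G))])) 1.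
Proof.
move=> n_gt0 sG; have [_ Ep] := eigs_complement n_gt0 sG.
(* The order on [algC] is partial: sorting is invariant under permutation here because all entries
   are real. *)
have Er : {in [seq 'Re z | z <- eigs G], forall x, x \is Num.real}.
  by move=> _ /mapP[z _ ->]; exact: Creal_Re.
have EpR : perm_eq [seq 'Re z | z <- eigs G]
    (0 :: [seq n%:R - 'Re z | z <- rem 0 (eigs (complement G))]).
  apply: perm_trans (perm_map _ Ep) _ => /=; rewrite raddf0 -map_comp perm_cons.
  rewrite (_ : map _ _ = [seq n%:R - 'Re z | z <- rem 0 (eigs (complement G))]) //.
  apply: eq_map => z /=; rewrite raddfB /=; congr (_ - _).
  by apply/Creal_ReP; rewrite realn.
rewrite /alg_conn; congr (nth 0 _ 1); apply/perm_sort_inP: EpR.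
- by move=> x y /Er Rx /Er Ry; exact: real_leVge.
- by move=> x y z _ _ _; exact: le_trans.
- by move=> x y _ _; exact: le_anti.
Qed.

Lemma alg_conn_ge G (c : algC) : (1 < n)%N -> simple_digraph G -> 0 < c ->
  (c <= alg_conn G) = all (fun z => 'Re z <= n%:R - c) (rem 0 (eigs (complement G))).
Proof.
move=> n_gt1 sG c_gt0; have n_gt0 := ltnW n_gt1.
have [s0 _] := eigs_complement n_gt0 sG.
rewrite alg_conn_eq_second // second_smallest_ge //.
- rewrite all_map; apply: eq_all => z /=.
  by rewrite lerBrDr addrC -lerBrDr.
- exact: gtr0_real.
- apply/allP=> _ /mapP[z _ ->]; apply: realB; [exact: realn | exact: Creal_Re].
have sz : size (eigs (complement G)) = n.
  apply: succn_inj; rewrite -[RHS](size_char_poly (laplacian (complement G))).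
  by rewrite eigsE size_prod_XsubC.
by rewrite -size_eq0 size_map size_rem // sz; case: (n) n_gt1 => [|[]].
Qed.

Lemma alg_conn_real G : alg_conn G \is Num.real.
Proof.
rewrite /alg_conn; set u := sort _ _.
have [u_le1 | /(mem_nth 0)] := leqP (size u) 1; first by rewrite nth_default.
by rewrite mem_sort => /mapP[z _ ->]; exact: Creal_Re.
Qed.

Lemma alg_conn_max G : (1 < n)%N -> simple_digraph G -> (0 < #|complement G|)%N ->
  alg_conn G <= (n - 1)%:R /\ (alg_conn G = (n - 1)%:R <-> branching (complement G)).
Proof.
move=> n_gt1 sG H_gt0; have n_gt0 := ltnW n_gt1.
set c : algC := (n - 1)%:R.
have c_gt0 : 0 < c by rewrite ltr0n subn_gt0.
have cE : c = n%:R - 1 by rewrite /c natrB.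
have nc : n%:R - c = 1 by rewrite cE opprB addrC subrK.
have [s0 _] := eigs_complement n_gt0 sG.
have ge_c : reflect (forall z, z \in eigs (complement G) -> 'Re z <= 1) (c <= alg_conn G).
  rewrite alg_conn_ge // nc; apply: (iffP allP) => Re1 z.
    by rewrite (perm_mem (perm_to_rem s0)) inE => /predU1P[-> | /Re1 //]; rewrite raddf0 ler01.
  by move=> /mem_rem/Re1.
have le_c : alg_conn G <= c.
  rewrite real_leNgt ?alg_conn_real ?realn //; apply/negP=> lt_c.
  have [_ [z sz Rez]] := branching_of_eigs (@complement_simple G) H_gt0 (elimT ge_c (ltW lt_c)).
  (* The criterion is used with [alg_conn G] itself as the bound: the eigenvalue [z] of real part 1
     then gives [alg_conn G <= n - 1]. *)
  have := lexx (alg_conn G).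
  rewrite alg_conn_ge ?(lt_trans c_gt0) // => /allP/(_ z).
  have z0 : z != 0 by apply: contra_eq_neq Rez => ->; rewrite raddf0 eq_sym oner_eq0.
  move: sz; rewrite (perm_mem (perm_to_rem s0)) inE (negPf z0) /= => -> /(_ isT).
  by rewrite Rez lerBrDr -lerBrDl -cE (lt_geF lt_c).
split=> //; split=> [a_c | bH].
  apply: (branching_of_eigs (@complement_simple G) H_gt0 (elimT ge_c _)).1.
  by rewrite a_c.
apply/le_anti; rewrite le_c; apply/ge_c => z.
case/(branching_eigs (@complement_simple G) bH) => ->; first by rewrite raddf0 ler01.
by rewrite (elimT (Creal_ReP _)) ?real1.
Qed.

(** * Branchings and directed forests *)

Lemma connect_last_arc G r v : connect (arc G) r v -> v != r ->
  exists2 u, connect (arc G) r u & (u, v) \in G.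
Proof.
case/connectP=> p; case/lastP: p => [|p w] /=; first by move=> _ ->; rewrite eqxx.
rewrite rcons_path last_rcons => /andP[rp pw] -> _.
by exists (last r p) => //; apply/connectP; exists p.
Qed.

(** The path from [r'] to [v] is followed backwards: a vertex has one in-arc at most, so [r] also
    reaches the previous vertex, and finally [r']. As [r'] has in-degree 0, it is [r]. *)
Lemma branching_root_uniq G r r' v : (forall i, (indeg G i <= 1)%N) ->
    indeg G r = 0%N -> indeg G r' = 0%N ->
  connect (arc G) r v -> connect (arc G) r' v -> r = r'.
Proof.
move=> G1 /eqP/indeg_eq0P Gr /eqP/indeg_eq0P Gr' rv /connectP[p r'p vp].
have : connect (arc G) r r'.
  rewrite {}vp in rv; elim: p (r') r'p rv {Gr'} => //= y p IHp x /andP[xy yp] ry.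
  have [|u ru uy] := connect_last_arc (IHp y yp ry).
    by apply: contraNneq (Gr x) => <-.
  by rewrite (indeg_le1_uniq (G1 y) xy uy).
have [-> // | r'r rr'] := eqVneq r' r.
by have [u _] := connect_last_arc rr' r'r; rewrite (negPf (Gr' u)).
Qed.

Lemma indeg_induced G (B : {set 'I_n}) v :
    (forall p, p \in G -> (p.1 \in B) = (p.2 \in B)) ->
  indeg [set p in G | (p.1 \in B) && (p.2 \in B)] v = if v \in B then indeg G v else 0%N.
Proof.
move=> GB; case: ifP => vB.
  apply: eq_card => j; rewrite !inE /= vB andbT.
  by case: (boolP (_ \in G)) => // /GB /= ->.
by apply/eqP/indeg_eq0P => j; rewrite inE /= vB !andbF.
Qed.

(** The trees are the classes of vertices with a common root [rt v]. *)
Lemma branching_forest G : branching G -> directed_forest G (n - #|G|).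
Proof.
move=> [G1 Groot].
(* The default [v] is never taken, since [Groot] supplies a root. *)
pose rt v := odflt v [pick r | (indeg G r == 0%N) && connect (arc G) r v].
have rtP v : indeg G (rt v) = 0%N /\ connect (arc G) (rt v) v.
  rewrite /rt; case: pickP => [r /andP[/eqP Gr rv] // | nr].
  by have [r Gr rv] := Groot v; have := nr r; rewrite Gr rv.
have rtE r v : indeg G r = 0%N -> connect (arc G) r v -> rt v = r.
  by move=> Gr rv; have [Grt rtv] := rtP v; exact: branching_root_uniq G1 Grt Gr rtv rv.
have rt_arc u v : (u, v) \in G -> rt u = rt v.
  move=> uv; have [Gu ru] := rtP u; symmetry; apply: rtE => //.
  exact: connect_trans ru (connect1 uv).
pose R := [set r | indeg G r == 0%N]; pose B r := [set v | rt v == r].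
have rtR r : r \in R -> rt r = r by rewrite inE => /eqP Gr; exact: rtE.
have inB v : v \in B (rt v) by rewrite inE.
have RB v : B (rt v) \in B @: R by apply: imset_f; rewrite inE (rtP v).1.
have trivP : trivIset (B @: R).
  apply/trivIsetP=> _ _ /imsetP[r _ ->] /imsetP[s _ ->] rs.
  apply/pred0P=> v /=; rewrite !inE; apply/negP=> /andP[/eqP vr /eqP vs].
  by rewrite -vr -vs eqxx in rs.
have pb v : pblock (B @: R) v = B (rt v) by exact: def_pblock.
exists (B @: R); split.
- apply/and3P; split=> //.
    rewrite eqEsubset subsetT; apply/subsetP=> v _.
    by apply/bigcupP; exists (B (rt v)).
  apply/imsetP=> -[r rR /setP/(_ r)].
  by rewrite !inE rtR ?eqxx.
- rewrite card_in_imset => [|r s rR sR /setP/(_ r)]; last first.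
    by rewrite !inE rtR // eqxx => /esym/eqP.
  (* Each vertex either is a root or has in-degree 1, so roots and arcs together number [n]. *)
  apply/eqP; rewrite -(eqn_add2r #|G|) -sum_indeg -sum1_card.
  have -> : (\sum_(r in R) 1 = \sum_r (indeg G r == 0%N))%N.
    by rewrite big_mkcond; apply: eq_bigr => r _; rewrite inE; case: eqP.
  rewrite -big_split /= subnK; last first.
    by rewrite -[leqRHS]card_ord -sum1_card; exact: leq_sum.
  rewrite (eq_bigr (fun=> 1%N)) ?sum1_card ?card_ord // => i _.
  by move: (G1 i); case: (indeg G i) => [|[]].
- by move=> -[u v] /rt_arc /= uv; rewrite !pb uv.
move=> _ /imsetP[r rR ->]; split.
  exists r => [|v]; first by rewrite inE rtR.
  rewrite inE => /eqP vr; have [_] := rtP v; rewrite vr => /connectP[p rp ->].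
  (* The induction maintains [rt x = r] along the path, which therefore stays inside [B r]. *)
  elim: p {1 3 6 7}r (rtR r rR) rp => //= y p IHp x xr /andP[xy yp].
  have yr : rt y = r by rewrite -(rt_arc _ _ xy).
  by apply: connect_trans (connect1 _) (IHp y yr yp); rewrite /= !inE xr yr eqxx.
have GB p : p \in G -> (p.1 \in B r) = (p.2 \in B r).
  by case: p => u v /rt_arc /= uv; rewrite !inE uv.
(* Arcs inside [B r] are counted by their heads: none for [r], one for every other vertex. *)
rewrite -sum_indeg [in RHS](cardsD1 r) inE rtR // eqxx add1n subn1 /= -sum1_card.
rewrite [RHS]big_mkcond; apply: eq_bigr => v _; rewrite indeg_induced // in_setD1.
have [vB | _] := boolP (v \in B r); last by rewrite andbF.
rewrite andbT; move: vB; rewrite inE => /eqP vr.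
case: eqVneq => [-> | vr'] /=; first by apply/eqP; rewrite inE in rR.
have: indeg G v != 0%N.
  by apply: contra vr' => Gv; rewrite -vr rtR // inE.
by move: (G1 v); case: (indeg G v) => [|[]].
Qed.

(** In a tree on [B], each of the [#|B| - 1] vertices other than the root receives an arc, and there
    are only [#|B| - 1] arcs; so each receives exactly one and the root none. *)
Lemma forest_branching G k : directed_forest G k -> branching G.
Proof.
case=> P [/and3P[/eqP covP trivP _] _ GP dP].
suff vroot v : (indeg G v <= 1)%N /\
    exists2 r, indeg G r = 0%N & connect (arc G) r v.
  by split=> v; have [] := vroot v.
have covv u : u \in cover P by rewrite covP inE.
set B := pblock P v.
have BP : B \in P by rewrite pblock_mem.
have vB : v \in B by rewrite mem_pblock.
have GB p : p \in G -> (p.1 \in B) = (p.2 \in B).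
  by move=> /GP Ep; rewrite -!eq_pblock // Ep.
have [[r rB conn_r] cardG] := dP B BP.
have conn u : u \in B -> connect (arc G) r u.
  move=> /conn_r; apply: connect_sub => x y /and3P[_ _ xy].
  exact: connect1.
have deg_gt0 u : u \in B :\ r -> (0 < indeg G u)%N.
  rewrite !inE => /andP[ur /conn ru]; have [w _ wu] := connect_last_arc ru ur.
  by rewrite lt0n; apply/negP=> /indeg_eq0P/(_ w); rewrite wu.
have sumG : (indeg G r + \sum_(u in B :\ r) indeg G u = #|B :\ r|)%N.
  rewrite -(big_setD1 r rB) /= [RHS]cardsDS ?sub1set // cards1 -cardG -sum_indeg.
  by rewrite big_mkcond; apply: eq_bigr => u _; rewrite indeg_induced.
have sumB : (indeg G r + \sum_(u in B :\ r) (indeg G u).-1 = 0)%N.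
  apply: (@addnI #|B :\ r|); rewrite addn0 -[RHS]sumG addnCA; congr (_ + _)%N.
  rewrite -sum1_card -big_split /=; apply: eq_bigr => u /deg_gt0.
  by case: (indeg G u).
move/eqP: sumB; rewrite addn_eq0 => /andP[/eqP Gr sum0].
split; last by exists r; rewrite ?conn.
have [-> | vr] := eqVneq v r; first by rewrite Gr.
move: sum0; rewrite sum_nat_eq0 => /forallP/(_ v); rewrite !inE vr vB /=.
by case: (indeg G v) => [|[]].
Qed.

(** * Extremal graph and conclusion *)

(** An out-star with isolated vertices, whose complement will attain the maximum. *)
Lemma star_branching (c : 'I_n) e : (e < n)%N -> c = 0%N :> nat ->
  let G := [set p : 'I_n * 'I_n | (p.1 == c) && (0 < p.2 <= e)%N] in
  [/\ simple_digraph G, #|G| = e & branching G].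
Proof.
move=> e_lt_n c0 G.
have degG i : indeg G i = (0 < i <= e)%N.
  case: (boolP (0 < i <= e)%N) => ie.
    by apply: etrans (cards1 c); apply: eq_card => j; rewrite !inE /= ie andbT.
  by apply/eqP/indeg_eq0P => j; rewrite inE /= (negPf ie) andbF.
split.
- by move=> i; rewrite inE /=; apply/andP=> -[/eqP-> /andP[]]; rewrite c0.
- rewrite -sum_indeg (eq_bigr _ (fun i _ => degG i)).
  case: (n) e_lt_n => // n' e_le_n'.
  rewrite big_ord_recl /= add0n -[RHS](subn0 e).
  rewrite (eq_bigr (fun i : 'I_n' => if (i < e)%N then 1%N else 0%N)).
    by rewrite -big_mkcond -(big_ord_widen _ (fun=> 1%N)) // sum1_card card_ord subn0.
  by move=> i _; rewrite /= /bump leq0n add1n; case: ltnP.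
split=> [i | v]; first by rewrite degG leq_b1.
have [ve | nve] := boolP (0 < v <= e)%N.
  exists c; first by rewrite degG c0.
  by apply: connect1; rewrite /arc /= inE /= eqxx.
by exists v; rewrite ?degG ?(negPf nve).
Qed.

End Digraph.

Unset Implicit Arguments.

Theorem theorem2 (n m : nat) (hn : (2 <= n)%N)
  (hm1 : ((n - 1) ^ 2 <= m)%N) (hm2 : (m < n * (n - 1))%N) :
  [/\ (forall G : digraph n, simple_digraph G -> #|G| = m ->
         alg_conn G <= (n - 1)%:R),
      (exists G : digraph n,
         [/\ simple_digraph G, #|G| = m & alg_conn G = (n - 1)%:R])
    & (forall G : digraph n, simple_digraph G -> #|G| = m ->
         (alg_conn G = (n - 1)%:R <->
          directed_forest (complement G) (m - n * (n - 2))))].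
Proof.
have nn : (n * (n - 1) = n * (n - 2) + n)%N.
  by case: n hn {hm1 hm2} => [|[|k]] // _; rewrite !subSS !subn0 mulnS addnC.
(* As [n (n - 1) = (n - 1)^2 + (n - 1)], [hm1] says that the complement has fewer than [n] arcs. *)
have nn1 : (n * (n - 1) < m + n)%N.
  case: n hn hm1 {hm2 nn} => [|[|k]] // _; rewrite !subSS !subn0 => hm1.
  by rewrite mulSn mulnn addnS ltnS addnC leq_add2r.
have cardH (G : digraph n) : simple_digraph G -> #|G| = m -> (m + #|complement G| = n * (n - 1))%N.
  by move=> sG <-; rewrite card_complement // subn1.
have H_gt0 (G : digraph n) : simple_digraph G -> #|G| = m -> (0 < #|complement G|)%N.
  by move=> sG Gm; rewrite -(ltn_add2l m) addn0 cardH.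
split.
- by move=> G sG Gm; have [] := alg_conn_max hn sG (H_gt0 G sG Gm).
- pose e := (n * (n - 1) - m)%N.
  have e_lt_n : (e < n)%N by rewrite ltn_subLR // ltnW.
  have [sH Hm bH] := star_branching (c := Ordinal (ltnW hn)) e_lt_n erefl.
  set H := [set p | _] in sH Hm bH.
  have Gm : #|complement H| = m.
    apply: (@addnI #|H|); rewrite card_complement // Hm /e subn1 subnK //.
    by rewrite -subn1 ltnW.
  have sG := @complement_simple _ H.
  exists (complement H); split=> //.
  by apply/(alg_conn_max hn sG (H_gt0 _ sG Gm)).2; rewrite complementK.
move=> G sG Gm; have [_ a_max] := alg_conn_max hn sG (H_gt0 G sG Gm).
(* Adding [m] to both terms of the left difference turns it into [(m + n) - (n * (n - 2) + n)]. *)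
have <- : (n - #|complement G| = m - n * (n - 2))%N.
  by rewrite -(subnDl m) cardH // nn subnDr.
split=> [/a_max/branching_forest // | /forest_branching bH]; exact/a_max.
Qed.
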